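(* Let $(S, \cdot)$ be a positive semigroup with identity $e$, associated partial order $\preceq$, and set of irreducible elements $I$. Let $\boldsymbol{X}$ be a spatially homogeneous upward run chain on $(S, \cdot)$: its transition function $P$ satisfies $P(x, xi) = r_i$ for all $x \in S$ and $i \in I$, where $r_i > 0$ and $r := \sum_{i \in I} r_i < 1$ (so $P(x,e) = 1-r$ for all $x \in S$). Let $(I^*, \cdot)$ be the free semigroup on $I$, and consider the corresponding upward run chain on $I^*$, which moves from a word $a$ to the word $ai$ with probability $r_i$ for each $i \in I$, and from $a$ to the empty word with probability $1-r$. Then: (a) The standard invariant function $F^*$ of the chain on $I^*$ is $$F^*(i_1 i_2 \cdots i_n) = \prod_{k=1}^n r_{i_k}, \quad (i_1, i_2, \ldots, i_n) \in I^n,\ n \in \mathbb{N},$$ or equivalently $F^*(a) = \prod_{i \in I} r_i^{n_i(a)}$ for $a \in I^*$, where $n_i(a)$ is the number of times that the letter $i$ appears in the word $a$. (b) The chain on $I^*$ is positive recurrent (and hence so is $\boldsymbol{X}$, since the two chains have the same classification), and moreover the invariant distribution of the chain on $I^*$ is exponential. (c) The standard invariant function $F$ of $\boldsymbol{X}$ is given by $$F(x) = \sum_{i_1 i_2 \cdots i_n = x} F^*(i_1 i_2 \cdots i_n), \quad x \in S,$$ where the sum is over all factorings of $x$ over $I$, that is, over all words $i_1 i_2 \cdots i_n \in I^*$ (of any length $n \ge 0$) whose product in $S$ is $x$. (d) For the downward run chain $\boldsymbol{Y}$ obtained by reversing $\boldsymbol{X}$, with transition function $Q$, the function $x \mapsto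 Q(e,x)$ is the invariant probability density function $f$ (of $\boldsymbol{X}$ and of $\boldsymbol{Y}$).
   Context: A positive semigroup $(S,\cdot)$ is a set $S$ with an associative binary operation having an identity element $e$, no non-trivial inverses, and satisfying the left-cancellation law. The associated partial order is: $x \preceq y$ if and only if there exists $t \in S$ with $xt = y$; $e$ is the minimum element. It is assumed that the partially ordered set $(S, \preceq)$ is discrete and that $[e,x] = \{t \in S : t \preceq x\}$ is finite for each $x \in S$. An element $i \in S$, $i \ne e$, is irreducible if it cannot be factored except for the trivial factorings $i = ie = ei$; $I$ is the set of irreducible elements. An element $y$ covers $x$ if $y$ is a minimal element of $\{t \in S : t \succ x\}$; the set $A_x$ of elements covering $x$ is $A_x = \{xi : i \in I\}$, and $B_x$ denotes the set of elements that $x$ covers. The free semigroup $(I^*, \cdot)$ is the set of finite words over the alphabet $I$ (including the empty word, its identity, also denoted $e$) with concatenation as the operation. It is itself a positive semigroup, with $a \preceq b$ if and only if $a$ is a prefix of $b$. It is isomorphic to the path space of $(S, \preceq)$ (the finite directed paths in the covering graph of $S$ starting at $e$, ordered by prefix): the word $i_1 i_2 \cdots i_n$ corresponds to a path from $e$ to the product $x = i_1 i_2 \cdots i_n$ in $S$. An upward run chain on a partially ordered set with minimum element $e$ is a Markov chain (discrete time) whose transition function $P$ satisfies $P(x,y) > 0$ if and only if $y$ covers $x$ or $y = e$. A downward run chain is a Markov chain whose transition function $Q$ satisfies $Q(x,y) > 0$ if and only if $x = e$, or $x \neq e$ and $y \in B_x$. For an upward run chain $(X_0, X_1, \ldots)$,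 let $T_x = \min\{n \ge 1 : X_n = x\}$ and let $\mathbb{P}_e$ denote probability given $X_0 = e$; the standard invariant function is $F(x) = \mathbb{P}_e(T_x \le T_e)$. In the recurrent case it is left-invariant for $P$, and in the positive recurrent case the invariant probability density function is $f(x) = F(x)/\sum_{y} F(y)$. The downward run chain obtained by reversing a recurrent upward run chain has transition function $Q$ determined by $F(y) Q(y,x) = F(x) P(x,y)$ for all states $x, y$. A probability distribution on a positive semigroup $S$ (here applied to $I^*$), with random variable $Z$, is exponential if $\mathbb{P}(Z \in xA) = \mathbb{P}(Z \in xS)\,\mathbb{P}(Z \in A)$ for all $x \in S$ and $A \subseteq S$, where $xA = \{xa : a \in A\}$. *)

(* Defs.v *)
From HB Require Import structures.
From mathcomp Require Import all_boot all_order all_algebra.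
From mathcomp Require Import all_classical all_reals all_analysis.

Set Implicit Arguments.
Unset Strict Implicit.
Unset Printing Implicit Defensive.

Import Order.TTheory GRing.Theory Num.Theory.

Local Open Scope classical_set_scope.
Local Open Scope ring_scope.

Section PositiveSemigroup.
Variable S : monoidType.
Implicit Types x y t : S.

Definition prec x y : Prop := exists t, (x * t)%g = y.

Definition sprec x y : Prop := prec x y /\ x <> y.

Definition covers y x : Prop :=
  sprec x y /\ forall t, sprec x t -> prec t y -> t = y.

(* The last field is the standing local finiteness assumption; it makes every
   order interval finite, so the order is in particular discrete. *)
Record positive_semigroup : Prop := PositiveSemigroup {
  no_inverses : forall x y, (x * y)%g = 1%g -> x = 1%g /\ y = 1%g ;
  left_cancellation : forall x y z, (x * y)%g = (x * z)%g -> y = z ;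
  finite_intervals : forall x, finite_set [set t | prec t x] }.

Definition irreducibles : set S :=
  [set i | i <> 1%g /\
           forall x y, i = (x * y)%g -> x = 1%g \/ y = 1%g].

End PositiveSemigroup.
Arguments positive_semigroup : clear implicits.
Arguments irreducibles : clear implicits.

(* A copy of [seq I], to carry concatenation as a monoid law. *)
Definition free_semigroup (I : Type) : Type := seq I.

Definition letter (I : Type) (i : I) : free_semigroup I := [:: i].

HB.instance Definition _ (I : choiceType) :=
  Choice.copy (free_semigroup I) (seq I).
HB.instance Definition _ (I : choiceType) :=
  isMonoid.Build (free_semigroup I) (@catA I) (@cat0s I) (@cats0 I).

Definition word_product (S : monoidType)
    (a : free_semigroup (irreducibles S)) : S :=
  \big[*%g/1%g]_(i <- a) val i.

Section Distribution.
Variables (R : realType) (T : choiceType).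
Implicit Types (g : T -> R) (A : set T).

Definition mass g A : \bar R := \esum_(x in A) (g x)%:E.

Definition pdf g : Prop := (forall x, 0 <= g x) /\ mass g setT = 1%E.

Definition normalized g : T -> R := fun x => g x / fine (mass g setT).

Definition transition_function (P : T -> T -> R) : Prop :=
  forall x, pdf (P x).

Definition invariant_pdf (P : T -> T -> R) g : Prop :=
  pdf g /\
  forall y, (\esum_(x in [set: T]) (g x * P x y)%:E)%E = (g y)%:E.

Definition is_the_invariant_pdf (P : T -> T -> R) g : Prop :=
  invariant_pdf P g /\ forall h, invariant_pdf P h -> h = g.

End Distribution.

Section RunChain.
Variables (R : realType) (S : monoidType).

Definition upward_run_chain (P : S -> S -> R) : Prop :=
  transition_function P /\
  forall x y, 0 < P x y <-> covers y x \/ y = 1%g.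

Definition downward_run_chain (Q : S -> S -> R) : Prop :=
  transition_function Q /\
  forall x y, 0 < Q x y <-> x = 1%g \/ (x <> 1%g /\ covers x y).

(* [g] is the density of [Z], so [mass g A] is the probability that [Z] is
   in [A]. *)
Definition exponential_distribution (g : S -> R) : Prop :=
  forall (x : S) (A : set S),
    mass g [set (x * a)%g | a in A] =
    (mass g [set (x * t)%g | t in setT] * mass g A)%E.

End RunChain.

Section MarkovChain.
Variables (R : realType) (d : measure_display) (Omega : measurableType d).

(* [Pr x] is the law under which the chain starts at [x]. The Markov property
   is multiplied out, which avoids conditioning on null histories. *)
Record markov_chain (S : choiceType) (P : S -> S -> R)
    (Pr : S -> probability Omega R) (X : nat -> Omega -> S) : Prop :=
  MarkovChain {
    chain_measurable : forall n x, measurable [set w | X n w = x] ;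
    chain_start : forall x, Pr x [set w | X 0%N w = x] = 1%E ;
    chain_markov : forall x n (s : nat -> S),
      Pr x [set w | forall k, (k <= n.+1)%N -> X k w = s k] =
      (Pr x [set w | forall k, (k <= n)%N -> X k w = s k] *
       (P (s n) (s n.+1))%:E)%E }.

(* The infimum of the empty set is +oo: a state never visited has an infinite
   hitting time. *)
Definition return_time (S : Type) (X : nat -> Omega -> S) (x : S) (w : Omega)
    : \bar R :=
  ereal_inf [set (n%:R)%:E | n in [set n | (1 <= n)%N /\ X n w = x]].

Definition positive_recurrent (S : Type)
    (Pr : S -> probability Omega R) (X : nat -> Omega -> S) : Prop :=
  forall x, (\int[Pr x]_w return_time X x w < +oo)%E.

Definition standard_invariant (S : monoidType)
    (Pr : S -> probability Omega R) (X : nat -> Omega -> S) (x : S) : R :=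
  fine (Pr 1%g [set w | (return_time X x w <= return_time X 1%g w)%E]).

End MarkovChain.

(* Main.v *)
Require Import Defs.
From HB Require Import structures.
From mathcomp Require Import all_boot all_order all_algebra.
From mathcomp Require Import all_classical all_reals all_analysis.

Set Implicit Arguments.
Unset Strict Implicit.
Unset Printing Implicit Defensive.

Import Order.TTheory GRing.Theory Num.Theory.

Local Open Scope classical_set_scope.
Local Open Scope ring_scope.

(** Both chains move by the same rule: multiply the current state on the right
    by the generator [g i] with probability [r i], or reset to the identity with
    the remaining probability [q = reset_rate r]. The record [homogeneous_run]
    states this rule on any left-cancellative monoid that is generated by the
    [g i] and in which no nonempty product of generators is the identity. The
    semigroup [S] with its irreducible elements ([semigroup_run]) and the words
    with their letters ([free_run]) are two instances. The formula for [F] on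
    words is the formula for [F] on a general monoid, read where every element
    is the product of exactly one word.

    Started at the identity, the chain spells a word [v] and then resets. The
    events [excursion v] are pairwise disjoint and have probabilities
    [q * weight r v], so the weights of all words have a sum at most [q^-1].
    Removing the last letter shows that a finite sum [s] of weights satisfies
    [s = 1 + (1 - q) * s], so the sum is [q^-1] ([weight_sum]), the excursions
    have total probability 1, and almost every trajectory starts with one of
    them. During an excursion [v] the chain visits [x] no later than the
    identity exactly if some prefix of [v] has the product [x]. By cancellation
    [v] has at most one such prefix, so [F x] is the sum of the weights of the
    words with product [x] ([standard_invariantE]).

    From any state, a reset followed by the spelling of a fixed word with
    product [x] leads to [x] in a bounded time with a probability bounded below. Hence
    the probability of avoiding [x] for [n] steps decays by a constant factor
    over blocks of fixed length ([avoids_decay]), and the return time, which is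
    the number of [n] for which [x] is avoided for [n] steps, has a finite
    expectation.

    [F] is invariant because a nonempty word is a word followed by a letter
    ([density_invariant]). The total mass of [F] is the sum of all weights,
    [q^-1]. Uniqueness holds for any irreducible transition function
    ([irreducible_invariant_unique]), hence for [P] and for its reversal [Q].
    Finally [F 1 = 1] and every state resets with the same probability [q], so
    [Q 1 x = F x * P x 1 = q * F x], which is the normalized density at [x]. *)

(** * Sums over arbitrary index sets *)

Section NonnegativeSums.
Variable R : realType.
Local Open Scope ereal_scope.

Lemma esum_term_le (T : choiceType) (D : set T) (a : T -> \bar R) i :
  (forall j, D j -> 0 <= a j) -> D i -> a i <= \esum_(j in D) a j.
Proof.
move=> a0 Di; apply: esum_ge; exists [set i]; last by rewrite fsbig_set1.
by split=> [|_ ->//]; exact: finite_set1.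
Qed.

Lemma esum_eq0 (T : choiceType) (a : T -> \bar R) :
  (forall j, 0 <= a j) -> \esum_(j in setT) a j = 0 -> forall i, a i = 0.
Proof.
move=> a0 s0 i; apply/eqP; rewrite eq_le a0 andbT -s0.
by apply: esum_term_le.
Qed.

Lemma esumZl (T : choiceType) (D : set T) (c : R) (a : T -> \bar R) :
  (0 <= c)%R -> (forall i, 0 <= a i) ->
  \esum_(i in D) (c%:E * a i) = c%:E * \esum_(i in D) a i.
Proof.
move=> c0 a0; rewrite /esum -ereal_supZl//; last first.
  by apply/set0P; exists (\sum_(x \in set0) a x), set0 => //; exact: fsets_set0.
congr ereal_sup; apply/seteqP; split=> [_ [A fA <-]|_ [_ [A fA <-] <-]].
  by exists (\sum_(x \in A) a x); [exists A|rewrite ge0_mule_fsumr].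
by exists A => //; rewrite ge0_mule_fsumr.
Qed.

Lemma esum_exchange (T U : choiceType) (a : T -> U -> \bar R) :
  (forall i j, 0 <= a i j) ->
  \esum_(i in setT) \esum_(j in setT) a i j =
  \esum_(j in setT) \esum_(i in setT) a i j.
Proof.
move=> a0; rewrite !esum_esum//.
rewrite (reindex_esum ([set: U] `*`` (fun=> [set: T])) _
  (fun k => (k.2, k.1)))//.
split=> //; last by move=> [i j] _; exists (j, i).
by move=> [i j] [k l] _ _ [-> ->].
Qed.

Lemma esum_fibres (T U : choiceType) (p : T -> U) (a : T -> \bar R) :
  (forall i, 0 <= a i) ->
  \esum_(x in setT) \esum_(i in [set i | p i = x]) a i = \esum_(i in setT) a i.
Proof.
move=> a0; rewrite esum_esum//; apply/esym/(reindex_esum _ _ snd); split.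
- by move=> [x i].
- by move=> [x i] [y j] /[!inE]/= -[_ <-] [_ <-] ->.
- by move=> i _; exists (p i, i).
Qed.

(** Only finitely many terms exceed any given [n.+1^-1]. *)
Lemma summable_gt0_countable (T : choiceType) (a : T -> R) :
  (forall i, (0 < a i)%R) -> \esum_(i in setT) (a i)%:E < +oo ->
  countable [set: T].
Proof.
move=> a0 afin.
have -> : [set: T] = \bigcup_n [set i | (n.+1%:R^-1 <= a i)%R].
  apply/seteqP; split=> // i _; exists (Num.truncn (a i)^-1) => //=.
  rewrite -[leRHS]invrK lef_pV2 ?posrE ?invr_gt0//.
  exact/ltW/truncnS_gt.
apply: bigcup_countable => // n _; apply: finite_set_countable.
apply: contrapT => infD; have := afin; apply/negP; rewrite -leNgt leye_eq.
apply/eqP/eqyP => M M0.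
have [B BD cB] := infinite_set_fset (Num.truncn (M * n.+1%:R)).+1 infD.
apply: esum_ge; exists [set` finmap.enum_fset B]; first by split.
rewrite -fsbig_seq// sumEFin lee_fin.
apply: (@le_trans _ _ (\sum_(i <- finmap.enum_fset B) n.+1%:R^-1)%R);
  last first.
  by rewrite big_seq [leRHS]big_seq; apply: ler_sum => i iB; exact: BD.
rewrite big_const_seq count_predT iter_addr_0 -[leRHS]mulr_natl.
rewrite ler_pdivlMr// (le_trans (ltW (truncnS_gt _)))// ler_nat.
exact: cB.
Qed.

Lemma measure_countable_bigcup d (T : measurableType d)
    (mu : {measure set T -> \bar R}) (I : choiceType) (D : set I)
    (F : I -> set T) :
  countable D -> (forall i, D i -> measurable (F i)) -> trivIset D F ->
  mu (\bigcup_(i in D) F i) = \esum_(i in D) mu (F i).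
Proof.
move=> /countable_bijP[B /pcard_eqP/bijPex[f [ffun finj fsurj]]] mF tF.
pose G n := \bigcup_(i in [set i | D i /\ f i = n]) F i.
have Gf i : D i -> G (f i) = F i.
  move=> Di; apply/seteqP; split=> [w [j [Dj /finj]]|w Fw]; last by exists i.
  by rewrite !inE => ->.
rewrite -(eq_bigcupr Gf) -(reindex_bigcup f D B G ffun fsurj) measure_bigcup.
- rewrite nneseries_esum// (reindex_esum D _ f); last first.
    by split=> //= n; rewrite /= inE; [exact: ffun|exact: fsurj].
  by apply: eq_esum => i Di; rewrite Gf.
- by move=> _ /fsurj[i Di <-]; rewrite Gf//; exact: mF.
- move=> _ _ /fsurj[i Di <-] /fsurj[j Dj <-]; rewrite !Gf//.
  by move=> /(tF _ _ Di Dj) ->.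
Qed.

Lemma countable_bigcup_measurable d (T : measurableType d)
    (I : choiceType) (D : set I) (F : I -> set T) :
  countable [set: I] -> (forall i, D i -> measurable (F i)) ->
  measurable (\bigcup_(i in D) F i).
Proof.
move=> cI mF; rewrite bigcup_mkcond.
apply: countable_bigcupT_measurable => // i.
by case: ifPn => // /set_mem; exact: mF.
Qed.
End NonnegativeSums.

(** * Words and homogeneous runs *)

Section Words.
Variables (R : realType) (M : monoidType) (I : choiceType).
Variables (g : I -> M) (r : I -> R).

Definition word_prod (w : seq I) : M := \big[*%g/1%g]_(i <- w) g i.

Definition weight (w : seq I) : R := \prod_(i <- w) r i.

Lemma word_prod_nil : word_prod [::] = 1%g.
Proof. by rewrite /word_prod big_nil. Qed.

Lemma word_prod_cons i w : word_prod (i :: w) = (g i * word_prod w)%g.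
Proof. by rewrite /word_prod big_cons. Qed.

Lemma word_prod_cat v w : word_prod (v ++ w) = (word_prod v * word_prod w)%g.
Proof.
elim: v => [|i v IHv]; first by rewrite word_prod_nil mul1g.
by rewrite cat_cons !word_prod_cons IHv mulgA.
Qed.

Lemma word_prod_rcons w i : word_prod (rcons w i) = (word_prod w * g i)%g.
Proof. by rewrite -cats1 word_prod_cat word_prod_cons word_prod_nil mulg1. Qed.

Lemma weight_nil : weight [::] = 1.
Proof. by rewrite /weight big_nil. Qed.

Lemma weight_cat v w : weight (v ++ w) = weight v * weight w.
Proof. by rewrite /weight big_cat. Qed.

Lemma weight_rcons w i : weight (rcons w i) = weight w * r i.
Proof. by rewrite -cats1 weight_cat /weight big_seq1. Qed.

Lemma weight_gt0 : (forall i, 0 < r i) -> forall w, 0 < weight w.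
Proof. by move=> r0 w; apply: prodr_gt0. Qed.

Lemma countable_words : countable [set: I] -> countable [set: seq I].
Proof.
move=> /countable_injP[f finj]; apply/countable_injP.
exists (pickle \o map f) => v w _ _ /(pcan_inj pickleK) /inj_map; apply.
by move=> i j; apply: finj; rewrite inE.
Qed.

End Words.

(** Common form of the chain on the semigroup and the chain on words. The field
    [run_eq1] says that no nonempty product of generators is the identity, so
    a state reached without a reset is never the identity. *)
Record homogeneous_run (R : realType) (M : monoidType) (I : choiceType)
    (g : I -> M) (r : I -> R) (P : M -> M -> R) : Prop := HomogeneousRun {
  run_cancel : forall x y z : M, (x * y)%g = (x * z)%g -> y = z ;
  run_inj : injective g ;
  run_eq1 : forall w, word_prod g w = 1%g -> w = [::] ;
  run_gen : forall x, exists w, word_prod g w = x ;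
  run_gt0 : forall i, 0 < r i ;
  run_lt1 : (mass r [set: I] < 1)%E ;
  run_pdf : transition_function P ;
  run_up : forall x i, P x (x * g i)%g = r i ;
  run_reset : forall x, ((P x 1%g)%:E = 1 - mass r [set: I])%E }.

Arguments run_cancel {R M I g r P} _ x [y z].
Arguments run_inj {R M I g r P} _ [x1 x2].

Definition reset_rate (R : realType) (I : choiceType) (r : I -> R) : R :=
  fine (1 - mass r [set: I])%E.

(** The states [x * g i] are distinct and differ from the identity. This serves
    in both directions: for words it shows that no mass is left for other
    transitions, for the semigroup it gives the reset probability. *)
Lemma mass_up_or_reset (R : realType) (M : monoidType) (I : choiceType)
    (g : I -> M) (r : I -> R) (P : M -> M -> R) (x : M) :
  (forall y z : M, (x * y)%g = (x * z)%g -> y = z) -> injective g ->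
  (forall i, (x * g i)%g <> 1%g) -> (forall y, 0 <= P x y) ->
  (forall i, P x (x * g i)%g = r i) ->
  mass (P x) ([set 1%g] `|` [set (x * g i)%g | i in setT]) =
  ((P x 1%g)%:E + mass r [set: I])%E.
Proof.
move=> xcan ginj g1 P0 Pr; rewrite /mass (esumID [set 1%g]); last first.
  by move=> y _; rewrite lee_fin.
rewrite (_ : _ `&` _ = [set 1%g]); last first.
  by apply/seteqP; split=> [y []//|y ->]; split=> //; left.
rewrite esum_set1 ?lee_fin//; congr (_ + _)%E.
rewrite (_ : _ `&` _ = [set (x * g i)%g | i in setT]); last first.
  apply/seteqP; split=> [y [[]//]|_ [i _ <-]].
  by split; [right; exists i|exact: g1].
rewrite esum_image; first by apply: eq_esum => i _; rewrite Pr.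
by move=> i j _ _ /xcan; exact: ginj.
Qed.

Section HomogeneousRun.
Variables (R : realType) (M : monoidType) (I : choiceType).
Variables (g : I -> M) (r : I -> R) (P : M -> M -> R).
Hypothesis run : homogeneous_run g r P.

Local Notation prod := (word_prod g).
Local Notation q := (reset_rate r).

Let P0 x y : 0 <= P x y. Proof. by case: (run_pdf run x) => + _; apply. Qed.

Lemma letters_countable : countable [set: I].
Proof.
apply: (summable_gt0_countable (run_gt0 run)).
exact: (lt_trans (run_lt1 run) (ltry 1)).
Qed.

Lemma words_countable : countable [set: seq I].
Proof. exact: countable_words letters_countable. Qed.

(** Countability turns every event determined by finitely many steps into a
    countable union of events of prescribed finite paths. *)
Lemma states_countable : countable [set: M].
Proof.
have /countable_injP[f finj] := words_countable.
apply/countable_injP; exists (f \o (fun x => projT1 (cid (run_gen run x)))).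
move=> x y _ _ /=; case: cid => v /= <-; case: cid => w /= <- /finj.
by rewrite !inE => ->.
Qed.

Lemma mass_rateE : mass r setT = (1 - q)%:E.
Proof.
have mfin : mass r setT \is a fin_num.
  rewrite ge0_fin_numE ?esum_ge0//; last first.
    by move=> i _; rewrite lee_fin ltW// (run_gt0 run).
  exact: (lt_trans (run_lt1 run) (ltry 1)).
by rewrite /reset_rate -(fineK mfin) -EFinB /= opprB addrC subrK.
Qed.

Lemma reset_rate_gt0 : 0 < q.
Proof. by have := run_lt1 run; rewrite mass_rateE lte_fin gtrBl. Qed.

Lemma P_resetE x : P x 1%g = q.
Proof.
apply: EFin_inj; rewrite (run_reset run) mass_rateE -EFinB; congr (_ %:E).
by rewrite opprB addrC subrK.
Qed.

Lemma step_neq1 x i : (x * g i)%g <> 1%g.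
Proof.
have [w <-] := run_gen run x; rewrite -word_prod_rcons => /(run_eq1 run).
by case: w.
Qed.

Lemma P_other x y : y <> 1%g -> (forall i, (x * g i)%g <> y) -> P x y = 0.
Proof.
move=> y1 yg; have [_] := run_pdf run x.
pose U := [set 1%g] `|` [set (x * g i)%g | i in setT].
have P0E z : (0 <= (P x z)%:E)%E by rewrite lee_fin.
have mU := mass_up_or_reset (run_cancel run x) (run_inj run)
  (@step_neq1 x) (P0 x) (run_up run x).
rewrite /mass (esumID U)// setTI -/(mass (P x) U) mU.
rewrite P_resetE mass_rateE -EFinD subrKC => s1.
have s0 : (\esum_(z in setT `&` ~` U) (P x z)%:E = 0)%E.
  by rewrite -[LHS](@addeK _ 1%E)// [(_ + 1)%E]addeC s1 subee.
apply/eqP; rewrite eq_le P0 andbT -lee_fin -[leRHS]s0.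
apply: (@esum_term_le _ _ (setT `&` ~` U) (fun z => (P x z)%:E)) => //.
by split=> // -[//|[i _ /yg]].
Qed.

Lemma P_stepE x y : y <> 1%g ->
  (P x y)%:E = \esum_(i in [set i | (x * g i)%g = y]) (r i)%:E.
Proof.
move=> y1; have [[i xi]|no] := pselect (exists i, (x * g i)%g = y).
  rewrite (_ : [set _ | _] = [set i]); last first.
    apply/seteqP; split=> [j /= xj|_ -> //].
    by apply/(run_inj run)/(run_cancel run x); rewrite xi.
  by rewrite esum_set1 ?lee_fin ?ltW ?(run_gt0 run)// -xi (run_up run).
rewrite P_other//; last by move=> i xi; apply: no; exists i.
rewrite (_ : [set _ | _] = set0) ?esum_set0//.
by apply/seteqP; split=> // i xi; apply: no; exists i.
Qed.

(** A path without resets determines the letters that were spelled, by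
    cancellation one step after the other. *)
Lemma same_path_prefix v w : (size v <= size w)%N ->
  (forall k, (k <= size v)%N -> prod (take k v) = prod (take k w)) ->
  v = take (size v) w.
Proof.
elim: v w => [|i v IHv] [|j w]//= vw vwE.
have ij : i = j.
  apply: (run_inj run); have := vwE 1%N isT.
  by rewrite /= !take0 !word_prod_cons word_prod_nil !mulg1.
rewrite -ij -IHv// => k kv; apply: (run_cancel run (g i)).
by have := vwE k.+1 kv; rewrite /= !word_prod_cons -ij.
Qed.

End HomogeneousRun.

(** * Events determined by the past *)

Section MarkovPast.
Variables (R : realType) (M : monoidType) (P : M -> M -> R).
Variables (d : measure_display) (Omega : measurableType d).
Variables (Pr : M -> probability Omega R) (X : nat -> Omega -> M).
Hypothesis chain : markov_chain P Pr X.
Hypothesis cM : countable [set: M].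

(** The event [A] depends on the states at the times [0, ..., n] only. Stated
    without reference to measurability, which follows in [past_measurable]. *)
Definition past n (A : set Omega) : Prop :=
  forall w w', (forall k, (k <= n)%N -> X k w = X k w') -> A w -> A w'.

Definition history n (w : Omega) : seq M := mkseq (X^~ w) n.+1.

Lemma nth_history n w k : (k <= n)%N -> nth 1%g (history n w) k = X k w.
Proof. by move=> kn; rewrite nth_mkseq. Qed.

Lemma size_history n w : size (history n w) = n.+1.
Proof. exact: size_mkseq. Qed.

Lemma history_eq n w w' : (forall k, (k <= n)%N -> X k w = X k w') <->
  history n w = history n w'.
Proof.
split=> [ww'|ww' k kn]; last by rewrite -!(nth_history _ kn) ww'.
apply: (@eq_from_nth _ 1%g) => [|k]; rewrite !size_history// => kn.
by rewrite !nth_history// ww'.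
Qed.

Lemma past_partition n A : past n A ->
  A = \bigcup_(s in history n @` A) [set w | history n w = s].
Proof.
move=> pA; apply/seteqP; split=> [w Aw|w [_ [w' Aw' <-]] /=].
  by exists (history n w) => //; exists w.
by move=> /esym/history_eq/pA; apply.
Qed.

Lemma measurable_history n s : measurable [set w | history n w = s].
Proof.
have [sn|sn] := eqVneq (size s) n.+1; last first.
  rewrite (_ : [set _ | _] = set0)//; apply/seteqP; split=> // w /= ws.
  by move/eqP: sn; rewrite -ws size_history.
rewrite (_ : [set _ | _] =
    \bigcap_(k in `I_n.+1) [set w | X k w = nth 1%g s k]).
  apply: bigcap_measurable => [|k _]; first by exists 0%N.
  exact: (chain_measurable chain).
apply/seteqP; split=> [w /= <- k /= kn|w /= ws]; first by rewrite nth_history.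
apply: (@eq_from_nth _ 1%g) => [|k]; rewrite !size_history ?sn// => kn.
by rewrite nth_history// ws.
Qed.

Lemma past_measurable n A : past n A -> measurable A.
Proof.
move=> pA; rewrite (past_partition pA).
apply: countable_bigcup_measurable => [|s _]; first exact: countable_words.
exact: measurable_history.
Qed.

Lemma pastS n m A : (n <= m)%N -> past n A -> past m A.
Proof.
move=> nm pA w w' ww'; apply: pA => k kn; apply: ww'; exact: leq_trans nm.
Qed.

Lemma pastI n A B : past n A -> past n B -> past n (A `&` B).
Proof. by move=> pA pB w w' ww' [/(pA _ _ ww') ? /(pB _ _ ww')]. Qed.

Lemma past_visit n x : past n [set w | X n w = x].
Proof. by move=> w w' ww' /= <-; rewrite ww'. Qed.

(** The Markov property for an event of the past instead of a single path: sum
    over the countably many paths up to time [n] that the event contains. *)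
Lemma past_step n A x z p : past n A -> 0 <= p ->
  (forall w, A w -> P (X n w) z = p) ->
  Pr x (A `&` [set w | X n.+1 w = z]) = (p%:E * Pr x A)%E.
Proof.
move=> pA p0 Ap; have cS := @countable_words M cM.
have cD : countable (history n @` A).
  by apply: sub_countable cS; exact/subset_card_le/subsetT.
have tH (E : set Omega) : trivIset (history n @` A)
    (fun s => [set w | history n w = s] `&` E).
  by move=> s t _ _ [w [[/= <- _] [/= <- _]]].
rewrite {1}(past_partition pA) setI_bigcupl measure_countable_bigcup//;
  last first.
  move=> s _; apply: measurableI; first exact: measurable_history.
  exact: (chain_measurable chain).
rewrite [in RHS](past_partition pA) measure_countable_bigcup//; last 2 first.
- by move=> s _; exact: measurable_history.
- by move=> s t _ _ [w [/= <- <-]].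
rewrite -esumZl//; apply: eq_esum => _ [w Aw <-].
(* [s] is the path of [w] up to time [n] followed by [z]; its values after time
   [n.+1], here the default [1], are irrelevant. *)
pose s := nth 1%g (rcons (history n w) z).
have sE k : (k <= n)%N -> s k = X k w.
  by move=> kn; rewrite /s nth_rcons size_history ltnS kn nth_history.
have sz : s n.+1 = z by rewrite /s nth_rcons size_history ltnn eqxx.
have -> : [set w' | history n w' = history n w] =
    [set w' | forall k, (k <= n)%N -> X k w' = s k].
  apply/seteqP; split=> w' /= ww'; last first.
    by apply/history_eq => k kn; rewrite ww'// sE.
  by move=> k kn; rewrite sE//; move: k kn; apply/history_eq.
rewrite muleC -(Ap w)// -(sE n)// -{2}sz -(chain_markov chain).
congr (Pr x _); apply/seteqP; split=> w' /=.
  move=> [ww' w'z] k; rewrite leq_eqVlt ltnS => /predU1P[->|/ww'//].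
  by rewrite sz.
move=> ww'; split=> [k kn|]; last by rewrite ww'.
by rewrite ww'// leqW.
Qed.

End MarkovPast.

(** * Excursions from the identity *)

Section WordSums.
Variables (R : realType) (M : monoidType) (I : choiceType).
Variables (g : I -> M) (r : I -> R) (P : M -> M -> R).
Hypothesis run : homogeneous_run g r P.

Local Notation prod := (word_prod g).
Local Notation wt := (weight r).
Local Notation q := (reset_rate r).
Local Open Scope ereal_scope.

Lemma weight_ge0 w : 0 <= (wt w)%:E.
Proof. by rewrite lee_fin ltW// weight_gt0//; exact: (run_gt0 run). Qed.

Lemma esum_words_rcons (a : seq I -> \bar R) : (forall w, 0 <= a w) ->
  \esum_(w in setT) a w =
  a [::] + \esum_(w in setT) \esum_(i in setT) a (rcons w i).
Proof.
move=> a0; rewrite (esumID [set [::]])// setTI esum_set1//; congr (_ + _).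
rewrite esum_esum// setTI.
rewrite -(esum_image _ (fun k : seq I * I => rcons k.1 k.2)).
  congr esum; apply/seteqP; split=> [|_ [[w i] _ <-] /= /(congr1 size)].
    by elim/last_ind=> [/(_ erefl)//|w i _ _]; exists (w, i).
  by rewrite size_rcons.
by move=> [v i] [w j] _ _ /= /rcons_inj.
Qed.

(** Every nonempty word is a word followed by a letter. As the sum may still be
    infinite here, this alone does not determine it. *)
Lemma weight_sum_rec :
  \esum_(w in setT) (wt w)%:E = 1 + (1 - q)%:E * \esum_(w in setT) (wt w)%:E.
Proof.
rewrite {1}esum_words_rcons; last exact: weight_ge0.
rewrite weight_nil; congr (_ + _).
have m0 : (0 <= 1 - q)%R.
  rewrite -lee_fin -(mass_rateE run); apply: esum_ge0 => i _.
  by rewrite lee_fin ltW// (run_gt0 run).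
rewrite -esumZl//; last exact: weight_ge0.
apply: eq_esum => w _; under eq_esum => i _ do rewrite weight_rcons EFinM.
rewrite esumZl; last 2 first.
- by have := weight_ge0 w; rewrite lee_fin.
- by move=> i; rewrite lee_fin ltW// (run_gt0 run).
by rewrite -/(mass r setT) (mass_rateE run) muleC.
Qed.

End WordSums.

Section ReturnTimes.
Variables (R : realType) (M : Type).
Variables (d : measure_display) (Omega : measurableType d).
Variable X : nat -> Omega -> M.
Local Notation T := (return_time R X).

(** The infimum that defines the return time is attained when it is finite. *)
Lemma return_time_leP x n w : (T x w <= n%:R%:E)%E <->
  exists k, [/\ (0 < k)%N, (k <= n)%N & X k w = x].
Proof.
split=> [|[k [k0 kn Xk]]]; last first.
  by apply: ge_ereal_inf; exists k%:R%:E; [exists k|rewrite lee_fin ler_nat].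
apply: contraPP => no; apply/negP; rewrite -ltNge.
apply: (@lt_le_trans _ _ n.+1%:R%:E); first by rewrite lte_fin ltr_nat.
apply: le_ereal_inf_tmp => _ [k [k0 Xk] <-]; rewrite lee_fin ler_nat ltnNge.
by apply/negP => kn; apply: no; exists k.
Qed.

(** Two infinite return times compare as well: the right-hand side is then
    vacuous. *)
Lemma return_time_le_returnP x y w : (T x w <= T y w)%E <->
  forall n, X n.+1 w = y -> exists k, [/\ (0 < k)%N, (k <= n.+1)%N & X k w = x].
Proof.
split=> [xy n Xn|xy].
  apply/return_time_leP/(le_trans xy)/return_time_leP.
  by exists n.+1.
apply: le_ereal_inf_tmp => _ [n [+ Xn] <-]; case: n Xn => // n /xy h _.
exact/return_time_leP.
Qed.

End ReturnTimes.

Section Excursions.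
Variables (R : realType) (M : monoidType) (I : choiceType).
Variables (g : I -> M) (r : I -> R) (P : M -> M -> R).
Hypothesis run : homogeneous_run g r P.
Variables (d : measure_display) (Omega : measurableType d).
Variables (Pr : M -> probability Omega R) (X : nat -> Omega -> M).
Hypothesis chain : markov_chain P Pr X.

Local Notation prod := (word_prod g).
Local Notation wt := (weight r).
Local Notation q := (reset_rate r).

Let cM : countable [set: M]. Proof. exact: states_countable run. Qed.
Let cW : countable [set: seq I]. Proof. exact: words_countable run. Qed.
Let r0 i : 0 <= r i. Proof. exact/ltW/(run_gt0 run). Qed.
Let wt0 w : 0 <= wt w. Proof. exact/ltW/weight_gt0/(run_gt0 run). Qed.
Let q0 : 0 <= q. Proof. exact/ltW/(reset_rate_gt0 run). Qed.

(** From time [n] on, the chain starts at [y] and spells [v]. *)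
Definition follows n (y : M) (v : seq I) : set Omega :=
  [set w | forall k, (k <= size v)%N -> X (n + k) w = (y * prod (take k v))%g].

Lemma follows_rcons n y v i : follows n y (rcons v i) =
  follows n y v `&` [set w | X (n + size v).+1 w = (y * prod (rcons v i))%g].
Proof.
apply/seteqP; split=> w /=.
  move=> fw; split=> [k kv|].
    by rewrite fw ?size_rcons ?leqW// -cats1 takel_cat.
  have := fw (size v).+1.
  by rewrite size_rcons addnS -(size_rcons v i) take_size; apply.
move=> [fw Xw] k; rewrite size_rcons leq_eqVlt => /predU1P[->|].
  by rewrite addnS Xw -(size_rcons v i) take_size.
by rewrite ltnS => kv; rewrite fw// -cats1 takel_cat.
Qed.

Lemma past_follows n y v : past X (n + size v) (follows n y v).
Proof.
by move=> w w' ww' fw k kv /=; rewrite -ww' ?leq_add2l// fw.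
Qed.

Lemma follows_last n y v w :
  follows n y v w -> X (n + size v) w = (y * prod v)%g.
Proof. by move=> /(_ _ (leqnn _)); rewrite take_size. Qed.

Lemma follows_weight x n A y v : past X n A -> (forall w, A w -> X n w = y) ->
  Pr x (A `&` follows n y v) = ((wt v)%:E * Pr x A)%E.
Proof.
move=> pA Ay; elim/last_ind: v => [|v i IHv].
  rewrite weight_nil mul1e; congr (Pr x _).
  apply/seteqP; split=> [w []//|w Aw]; split=> // k.
  by rewrite leqn0 => /eqP->; rewrite addn0 Ay// word_prod_nil mulg1.
rewrite follows_rcons setIA (past_step chain cM x (p := r i)) ?IHv//; last 2 first.
- by apply: pastI; [apply: pastS pA; exact: leq_addr|exact: past_follows].
- move=> w [_ /follows_last ->].
  by rewrite word_prod_rcons mulgA (run_up run).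
by rewrite weight_rcons EFinM muleCA muleA.
Qed.

Lemma prob_follows v : Pr 1%g (follows 0 1%g v) = (wt v)%:E.
Proof.
rewrite -[RHS]mule1 -(chain_start chain 1%g).
rewrite -(@follows_weight _ 0 [set w | X 0%N w = 1%g] 1%g)//; last first.
  exact: past_visit.
congr (Pr _ _); apply/seteqP; split=> [w fw|w []//]; split=> //=.
by have := fw 0%N isT; rewrite take0 word_prod_nil mulg1.
Qed.

(** The chain spells [v] from the identity and then resets; the time
    [(size v).+1] is then its first return to the identity. *)
Definition excursion (v : seq I) : set Omega :=
  follows 0 1%g v `&` [set w | X (size v).+1 w = 1%g].

Lemma prob_excursion v : Pr 1%g (excursion v) = (q%:E * (wt v)%:E)%E.
Proof.
rewrite (past_step chain cM _ (p := q)) ?prob_follows//.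
  exact: (@past_follows 0).
by move=> w _; exact: (P_resetE run).
Qed.

Lemma past_excursion v : past X (size v).+1 (excursion v).
Proof.
apply: pastI; last exact: past_visit.
by apply: (pastS (leqnSn _)); exact: (@past_follows 0).
Qed.

Lemma follows_first_return u n w :
  follows 0 1%g u w -> X n.+1 w = 1%g -> (size u <= n)%N.
Proof.
move=> fu Xn; rewrite leqNgt; apply/negP => nu.
have := fu _ nu; rewrite add0n Xn mul1g => /esym/(run_eq1 run)/(congr1 size).
by rewrite size_takel.
Qed.

(** The first return to the identity determines the length of the word, and the
    path up to that time determines the letters. *)
Lemma trivIset_excursion : trivIset setT excursion.
Proof.
move=> u v _ _ [w [[fu Xu] [fv Xv]]].
have uv : size u = size v.
  apply/eqP; rewrite eqn_leq.
  by rewrite (follows_first_return fu Xv) (follows_first_return fv Xu).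
rewrite -[RHS]take_size -uv.
apply: (same_path_prefix run); rewrite ?uv// => k ku.
by have := fv _ ku; rewrite fu ?uv// !mul1g.
Qed.

Lemma prob_excursions :
  Pr 1%g (\bigcup_v excursion v) = (q%:E * \esum_(v in setT) (wt v)%:E)%E.
Proof.
rewrite measure_countable_bigcup//; last 2 first.
- by move=> v _; apply: (past_measurable chain cM (@past_excursion v)).
- exact: trivIset_excursion.
by rewrite -esumZl//; apply: eq_esum => v _; exact: prob_excursion.
Qed.

(** The excursions are disjoint events, so the sum is finite, and the recursion
    [weight_sum_rec] has only one finite solution. *)
Lemma weight_sum : \esum_(v in setT) (wt v)%:E = (q^-1)%:E.
Proof.
set s := esum _ _.
have qgt0 := reset_rate_gt0 run.
have s0 : (0 <= s)%E by apply: esum_ge0 => v _; rewrite lee_fin.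
have sfin : s \is a fin_num.
  rewrite ge0_fin_numE//; apply: (@le_lt_trans _ _ (q^-1)%:E); last exact: ltry.
  rewrite -[leRHS]mule1 lee_pdivlMl//.
  rewrite -prob_excursions; apply: probability_le1.
  apply: countable_bigcup_measurable => // v _.
  by apply: (past_measurable chain cM (@past_excursion v)).
have := weight_sum_rec run; rewrite -/s -(fineK sfin) -EFinM -EFinD => -[sE].
congr (_ %:E); apply: (mulfI (lt0r_neq0 qgt0)); rewrite mulfV ?gt_eqF//.
by rewrite -{1}(subKr 1 q) mulrBl mul1r {1}sE addrK.
Qed.

Lemma prob_excursions1 : Pr 1%g (\bigcup_v excursion v) = 1%E.
Proof.
rewrite prob_excursions weight_sum -EFinM mulfV// gt_eqF//.
exact: reset_rate_gt0 run.
Qed.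

Definition reaches x : set Omega :=
  \bigcup_(v in [set v | prod v = x]) follows 0 1%g v.

Lemma measurable_reaches x : measurable (reaches x).
Proof.
apply: countable_bigcup_measurable => // v _.
exact: (past_measurable chain cM (@past_follows 0 _ v)).
Qed.

(** If two words with the same product are both spelled, the shorter one is a
    prefix of the longer one. By cancellation the remaining letters have the
    product 1, so there are none. *)
Lemma trivIset_follows x : trivIset [set v | prod v = x] (follows 0 1%g).
Proof.
have aux u v w : (size u <= size v)%N -> prod u = prod v ->
    follows 0 1%g u w -> follows 0 1%g v w -> u = v.
  move=> uv puv fu fv.
  have uE : u = take (size u) v.
    apply: (same_path_prefix run uv) => k ku.
    by have := fu _ ku; rewrite fv ?(leq_trans ku)// !mul1g.
  have : prod (drop (size u) v) = 1%g.
    apply: (run_cancel run (prod u)); rewrite mulg1 [RHS]puv.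
    by rewrite -[in RHS](cat_take_drop (size u) v) word_prod_cat -uE.
  move=> /(run_eq1 run) dE.
  by rewrite -[RHS](cat_take_drop (size u)) dE cats0.
move=> u v /= ux vx [w [fu fv]].
have uv : prod u = prod v by rewrite ux vx.
have [le_uv|/ltnW le_vu] := leqP (size u) (size v); first exact: aux uv fu fv.
exact/esym/(aux _ _ w).
Qed.

Lemma prob_reaches x :
  Pr 1%g (reaches x) = \esum_(v in [set v | prod v = x]) (wt v)%:E.
Proof.
rewrite measure_countable_bigcup//; last 3 first.
- by apply: sub_countable cW; exact/subset_card_le/subsetT.
- by move=> v _; exact: (past_measurable chain cM (@past_follows 0 _ v)).
- exact: trivIset_follows.
by apply: eq_esum => v _; exact: prob_follows.
Qed.

Definition before_reset x : set Omega :=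
  [set w | (return_time R X x w <= return_time R X 1%g w)%E].

Lemma measurable_before_reset x : measurable (before_reset x).
Proof.
rewrite (_ : before_reset x = \bigcap_n [set w | X n.+1 w = 1%g ->
    exists k, [/\ (0 < k)%N, (k <= n.+1)%N & X k w = x]]).
  apply: bigcapT_measurable => n; apply: (past_measurable chain cM (n := n.+1)).
  move=> w w' ww' /= h; rewrite -ww'// => /h[k [k0 kn Xk]].
  by exists k; rewrite -ww'.
apply/seteqP; split=> w.
  by move=> /return_time_le_returnP h n _; exact: h.
by move=> h; apply/return_time_le_returnP => n; exact: h.
Qed.

Lemma reaches_before_reset x : reaches x `<=` before_reset x.
Proof.
move=> w [v /= vx fv]; apply/return_time_le_returnP => n Xn.
have [v0|v0] := posnP (size v).
  by exists n.+1; split=> //; rewrite Xn -vx (size0nil v0) word_prod_nil.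
exists (size v); split=> //; last first.
  by rewrite -[size v]add0n (follows_last fv) mul1g.
exact: leqW (follows_first_return fv Xn).
Qed.

(** The visit to [x] takes place either while [v] is spelled, and then a prefix
    of [v] has the product [x], or at the reset, and then [x = 1] is the product of
    the empty word. *)
Lemma before_reset_excursion x v w :
  before_reset x w -> excursion v w -> reaches x w.
Proof.
move=> /return_time_le_returnP h [fv /[dup] Xv /h[k [k0 + Xk]]].
rewrite leq_eqVlt ltnS => /predU1P[kE|kv]; last first.
  exists (take k v) => /=; first by rewrite -Xk -[k]add0n fv// mul1g.
  move=> j; rewrite size_takel// => jk.
  by rewrite take_takel// fv// (leq_trans jk).
exists [::] => /=; first by rewrite word_prod_nil -Xk kE Xv.
by move=> [|//] _; have := fv 0%N isT; rewrite take0.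
Qed.

(** The events [before_reset x] and [reaches x] differ only on trajectories that
    begin with no excursion, a null event. *)
Lemma standard_invariantE x : (standard_invariant Pr X x)%:E =
  \esum_(v in [set v | prod v = x]) (wt v)%:E.
Proof.
rewrite /standard_invariant fineK; last first.
  by apply: fin_num_measure; exact: measurable_before_reset.
rewrite -prob_reaches; apply/eqP; rewrite eq_le; apply/andP; split; last first.
  apply: le_measure; rewrite ?inE; last exact: reaches_before_reset.
    exact: measurable_reaches.
  exact: measurable_before_reset.
have mE : measurable (\bigcup_v excursion v).
  apply: countable_bigcup_measurable => // v _.
  exact: (past_measurable chain cM (@past_excursion v)).
rewrite -[leRHS](@measureU0 _ _ _ _ _ (~` \bigcup_v excursion v)); last 3 first.
- exact: measurable_reaches.
- exact: measurableC.
- by have := probability_setC (Pr 1%g) mE; rewrite prob_excursions1 subee.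
apply: le_measure; rewrite ?inE; first exact: measurable_before_reset.
  by apply: measurableU; [exact: measurable_reaches|exact: measurableC].
move=> w wx.
have [[v _ ev]|] := pselect ((\bigcup_v excursion v) w); last by right.
by left; exact: before_reset_excursion ev.
Qed.

End Excursions.

(** * Positive recurrence *)

(** Summing [p] over [m + N] indices and shifting by [m] gives
    [s <= m + (1 - c) s] for the partial sum [s] over [N] indices. *)
Lemma sum_le_of_decay (R : realType) (p : nat -> R) (m : nat) (c : R) :
  0 < c -> (forall n, 0 <= p n <= 1) ->
  (forall n, p (n + m)%N <= (1 - c) * p n) ->
  forall N, \sum_(0 <= n < N) p n <= m%:R / c.
Proof.
move=> c0 p01 pm N; rewrite ler_pdivlMr//.
set s := \sum_(_ <= _ < _) _.
suff : s <= m%:R + (1 - c) * s.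
  by rewrite mulrBl mul1r addrCA lerDl subr_ge0 mulrC.
apply: (@le_trans _ _ (\sum_(0 <= n < m + N) p n)).
  rewrite addnC (big_cat_nat (n := N))//= ?leq_addr// lerDl.
  by apply: sumr_ge0 => n _; case/andP: (p01 n).
rewrite (big_cat_nat (n := m))//= ?leq_addr//; apply: lerD.
  rewrite -[leRHS]mul1r mulr_natr -[in leRHS](subn0 m) -sumr_const_nat.
  by apply: ler_sum => n _; case/andP: (p01 n).
rewrite -{1}[m]add0n big_addn addKn mulr_sumr.
by apply: ler_sum => n _.
Qed.

Section Avoids.
Variables (R : realType) (M : monoidType).
Variables (d : measure_display) (Omega : measurableType d).
Variable X : nat -> Omega -> M.

Definition avoids x n : set Omega :=
  [set w | forall k, (0 < k)%N -> (k <= n)%N -> X k w <> x].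

Lemma past_avoids x n : past X n (avoids x n).
Proof. by move=> w w' ww' aw k k0 kn; rewrite -ww'//; exact: aw. Qed.

(** Layer-cake formula: a return time [t] exceeds exactly the [t] numbers
    [0, ..., t.-1], and an infinite return time exceeds all [n]. *)
Lemma return_time_sum x w :
  return_time R X x w = (\sum_(0 <= n <oo) (\1_(avoids x n) w)%:E)%E.
Proof.
have s0 n : (0 <= (\1_(avoids x n) w)%:E :> \bar R)%E by rewrite lee_fin.
have [hit|nohit] := pselect (exists k, (0 < k)%N && (X k w == x)).
  case: (ex_minnP hit) => t /andP[t0 /eqP Xt] tmin.
  transitivity (t%:R%:E : \bar R).
    apply/eqP; rewrite eq_le; apply/andP; split.
      by apply/return_time_leP; exists t.
    apply: le_ereal_inf_tmp => _ [k [k0 Xk] <-]; rewrite lee_fin ler_nat.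
    by apply: tmin; rewrite k0 Xk eqxx.
  rewrite (nneseries_split 0 t)//.
  rewrite eseries0 ?adde0; last first.
    move=> n tn _; rewrite indicE memNset// => /(_ t t0).
    by rewrite add0n in tn; move=> /(_ tn).
  rewrite add0n (eq_big_nat _ _ (F2 := fun=> 1%E)).
    by rewrite sumEFin sumr_const_nat subn0.
  move=> n /andP[_ nt]; rewrite indicE mem_set// => k k0 kn Xk.
  have := tmin k; rewrite k0 Xk eqxx => /(_ isT).
  by rewrite leqNgt (leq_ltn_trans kn).
have a1 n : (\1_(avoids x n) w)%:E = 1%E :> \bar R.
  rewrite indicE mem_set// => k k0 kn Xk.
  by apply: nohit; exists k; rewrite k0 Xk eqxx.
rewrite /return_time (_ : [set _ | _ in _] = set0) ?ereal_inf0; last first.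
  apply/seteqP; split=> // t [k [k0 Xk] _].
  by apply: nohit; exists k; rewrite k0 Xk eqxx.
apply/esym/eqyP => A A0; pose n := (Num.truncn A).+1.
apply: le_trans (@nneseries_lim_ge _ _ xpredT 0 n (fun k _ _ => s0 k)).
under eq_bigr do rewrite a1.
by rewrite sumEFin sumr_const_nat subn0 lee_fin ltW// truncnS_gt.
Qed.

End Avoids.

Section PositiveRecurrence.
Variables (R : realType) (M : monoidType) (I : choiceType).
Variables (g : I -> M) (r : I -> R) (P : M -> M -> R).
Hypothesis run : homogeneous_run g r P.
Variables (d : measure_display) (Omega : measurableType d).
Variables (Pr : M -> probability Omega R) (X : nat -> Omega -> M).
Hypothesis chain : markov_chain P Pr X.

Local Notation wt := (weight r).
Local Notation q := (reset_rate r).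

Let cM : countable [set: M]. Proof. exact: states_countable run. Qed.
Let q0 : 0 < q. Proof. exact: (reset_rate_gt0 run). Qed.
Let measurable_avoids x n : measurable (avoids X x n).
Proof. exact: (past_measurable chain cM (@past_avoids _ _ _ _ _ _)). Qed.

(** A reset at time [n.+1] followed by the letters of [v] visits [x] at time
    [n + (size v).+1]. *)
Lemma avoids_decay x y v n : word_prod g v = x ->
  (Pr y (avoids X x (n + (size v).+1)) <=
   (1 - wt v * q)%:E * Pr y (avoids X x n))%E.
Proof.
move=> vx; set A := avoids X x n.
(* [C]: [x] is avoided up to time [n], then a reset, then the letters of [v]. *)
pose B := A `&` [set w | X n.+1 w = 1%g].
pose C := B `&` follows g X n.+1 1%g v.
have pA : past X n A by exact: past_avoids.
have pB : past X n.+1 B.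
  by apply: pastI; [exact: pastS pA|exact: past_visit].
have mA : measurable A by exact: measurable_avoids.
have mC : measurable C.
  apply: (past_measurable chain cM (n := n.+1 + size v)).
  by apply: pastI; [apply: pastS pB; exact: leq_addr|exact: past_follows].
have prC : Pr y C = ((wt v)%:E * (q%:E * Pr y A))%E.
  rewrite (follows_weight run chain)//; last by move=> w [].
  rewrite (past_step chain cM _ (p := q))//; first exact: ltW.
  by move=> w _; exact: P_resetE run _.
have CA : C `<=` A by move=> w [[]].
apply: (@le_trans _ _ (Pr y (A `\` C))).
  apply: le_measure; rewrite ?inE//; first exact: measurableD.
  move=> w aw; split=> [k k0 kn|[_ /follows_last]].
    by apply: aw => //; rewrite (leq_trans kn)// leq_addr.
  by rewrite mul1g vx; apply: aw => //; rewrite addSnnS.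
have -> : Pr y (A `\` C) = (Pr y A - Pr y C)%E.
  by rewrite measureD// ?setIidr// ltey_eq fin_num_measure.
have afin : Pr y A \is a fin_num by exact: fin_num_measure.
by rewrite prC -(fineK afin) -!EFinM -EFinB lee_fin mulrBl mul1r mulrA.
Qed.

Lemma homogeneous_positive_recurrent : positive_recurrent Pr X.
Proof.
move=> x; have [v vx] := run_gen run x.
have vq0 : 0 < wt v * q.
  by rewrite mulr_gt0// weight_gt0//; exact: (run_gt0 run).
under eq_integral do rewrite return_time_sum.
rewrite integral_nneseries//; last first.
  move=> n; apply/measurable_realfun.measurable_EFinP.
  exact: measurable_realfun.measurable_indic.
apply: (@le_lt_trans _ _ ((size v).+1%:R / (wt v * q))%:E); last exact: ltry.
apply: lime_le.
  apply: is_cvg_nneseries => n _ _.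
  by apply: integral_ge0 => w _; rewrite lee_fin.
apply: nearW => N.
pose p n := fine (Pr x (avoids X x n)).
have pE n : Pr x (avoids X x n) = (p n)%:E by rewrite fineK// fin_num_measure.
rewrite (eq_bigr (fun n => (p n)%:E)); last first.
  by move=> n _; rewrite integral_indic// setIT; exact: pE.
rewrite sumEFin lee_fin; apply: sum_le_of_decay => // n.
  by rewrite -!lee_fin -pE measure_ge0 probability_le1.
by rewrite -lee_fin EFinM -!pE avoids_decay.
Qed.

End PositiveRecurrence.

(** * Invariant densities and reversal *)

Section InvariantUniqueness.
Variables (R : realType) (T : choiceType).
Implicit Types f h : T -> R.

(** The differences [b i - a i] are nonnegative with sum 0. *)
Lemma esum_eq_le (a b : T -> R) : (forall i, 0 <= a i <= b i) ->
  \esum_(i in setT) (a i)%:E = \esum_(i in setT) (b i)%:E ->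
  (\esum_(i in setT) (b i)%:E < +oo)%E -> forall i, a i = b i.
Proof.
move=> ab sab sb i.
have a0 j : (0 <= (a j)%:E)%E by rewrite lee_fin; case/andP: (ab j).
have ba0 j : (0 <= (b j - a j)%:E)%E.
  by rewrite lee_fin subr_ge0; case/andP: (ab j).
have sE : (\esum_(j in setT) (b j)%:E =
    \esum_(j in setT) (a j)%:E + \esum_(j in setT) (b j - a j)%:E)%E.
  by rewrite -esumD//; apply: eq_esum => j _; rewrite -EFinD subrKC.
have sfin : \esum_(j in setT) (a j)%:E \is a fin_num.
  by rewrite ge0_fin_numE ?esum_ge0// sab.
have s0 : (\esum_(j in setT) (b j - a j)%:E = 0)%E.
  rewrite -[LHS](addeK _ sfin) [(_ + \esum_(j in _) (a j)%:E)%E]addeC.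
  by rewrite -sE -sab subee.
by have [/eqP] := esum_eq0 ba0 s0 i; rewrite subr_eq0 => /eqP.
Qed.

Variable P : T -> T -> R.
Hypothesis hP : transition_function P.

(** No nonempty proper set of states is closed under predecessors, which says
    that every state leads to every state along positive transitions. *)
Definition irreducible_transition : Prop := forall Z : set T,
  (exists z, Z z) -> (forall x y, Z y -> 0 < P x y -> Z x) -> forall x, Z x.

Let P0 x y : 0 <= P x y. Proof. by case: (hP x) => + _; apply. Qed.

(** One step maps [min h f] below both [h] and [f] and preserves its total mass,
    which is finite. *)
Let invariant_min h f : invariant_pdf P h -> invariant_pdf P f ->
  forall y, \esum_(x in setT) (Num.min (h x) (f x) * P x y)%:E =
            (Num.min (h y) (f y))%:E.
Proof.
move=> [[h0 h1] hinv] [[f0 f1] finv].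
pose m x := Num.min (h x) (f x).
have m0 x : 0 <= m x by rewrite le_min h0 f0.
have mP0 x y : (0 <= (m x * P x y)%:E)%E by rewrite lee_fin mulr_ge0.
pose mP y := \esum_(x in setT) (m x * P x y)%:E.
have mPm y : (mP y <= (m y)%:E)%E.
  rewrite /m /Num.min; case: ifP => _; [rewrite -hinv|rewrite -finv];
    apply: le_esum => x _; rewrite lee_fin ler_wpM2r// ge_min lexx ?orbT//.
have mPge0 y : (0 <= mP y)%E by apply: esum_ge0.
have mPfin y : mP y = (fine (mP y))%:E.
  by rewrite fineK// ge0_fin_numE//; apply: le_lt_trans (mPm y) (ltry _).
suff : forall y, fine (mP y) = m y by move=> e y; rewrite -/(mP y) mPfin e.
apply: esum_eq_le => [y||].
- by rewrite -!lee_fin -mPfin mPge0 mPm.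
- under eq_esum => y _ do rewrite -mPfin.
  rewrite esum_exchange//; apply: eq_esum => x _.
  under eq_esum => y _ do rewrite EFinM.
  have [_ Px1] := hP x.
  rewrite esumZl; [|exact: m0|by move=> y; rewrite lee_fin].
  by rewrite -/(mass (P x) setT) Px1 mule1.
- apply: (@le_lt_trans _ _ (mass h setT)); last by rewrite h1 ltry.
  by apply: le_esum => x _; rewrite lee_fin ge_min lexx.
Qed.

(** At a state where [k <= l], the invariant functions [min k l] and [k] agree,
    so they agree at each of its predecessors. The states where [k <= l] are thus
    closed under predecessors; if there is one, [k <= l] everywhere, and equal
    total masses give [k = l]. *)
Lemma irreducible_invariant_unique h f : irreducible_transition ->
  invariant_pdf P h -> invariant_pdf P f -> h = f.
Proof.
move=> irr; have aux k l x : invariant_pdf P k -> invariant_pdf P l ->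
    k x <= l x -> k = l.
  move=> kinv linv kx; have [[k0 k1] kP] := kinv; have [[l0 l1] lP] := linv.
  apply/funext; apply: esum_eq_le; last 2 first.
  - by rewrite -!/(mass _ _) k1 l1.
  - by rewrite -/(mass _ _) l1 ltry.
  suff kl y : k y <= l y by move=> y; rewrite k0 kl.
  apply: (irr [set y | k y <= l y]) => [|{}y z /= kz Pyz]; first by exists x.
  have : Num.min (k y) (l y) * P y z = k y * P y z.
    apply: (esum_eq_le (a := fun y => Num.min (k y) (l y) * P y z)
                       (b := fun y => k y * P y z)) => [w||].
    - by rewrite mulr_ge0 ?le_min ?k0 ?l0//= ler_wpM2r// ge_min lexx.
    - by rewrite (invariant_min kinv linv) kP min_l.
    - by rewrite kP ltry.
  by move=> /(mulIf (lt0r_neq0 Pyz)) <-; rewrite ge_min lexx orbT.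
move=> hinv finv; apply/funext => x.
have [le_hf|/ltW le_fh] := leP (h x) (f x); first by rewrite (aux h f x).
by rewrite (aux f h x).
Qed.

End InvariantUniqueness.

Section InvariantDensity.
Variables (R : realType) (M : monoidType) (I : choiceType).
Variables (g : I -> M) (r : I -> R) (P : M -> M -> R).
Hypothesis run : homogeneous_run g r P.

Local Notation prod := (word_prod g).
Local Notation wt := (weight r).
Local Notation q := (reset_rate r).

Variable F : M -> R.
Hypothesis FE : forall x,
  (F x)%:E = \esum_(v in [set v | prod v = x]) (wt v)%:E.
Hypothesis wt_sum : \esum_(v in setT) (wt v)%:E = (q^-1)%:E.

Let q0 : 0 < q. Proof. exact: reset_rate_gt0 run. Qed.
Let wt0 v : 0 < wt v. Proof. exact/weight_gt0/(run_gt0 run). Qed.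
Let ewt0 v : (0 <= (wt v)%:E)%E. Proof. by rewrite lee_fin ltW. Qed.
Let P0 x y : 0 <= P x y. Proof. by case: (run_pdf run x) => + _; apply. Qed.

Lemma density_gt0 x : 0 < F x.
Proof.
have [v vx] := run_gen run x; apply: (lt_le_trans (wt0 v)).
rewrite -lee_fin FE.
exact: (@esum_term_le _ _ [set v | prod v = x] (fun v => (wt v)%:E)).
Qed.

Let F0 x : 0 <= F x. Proof. exact/ltW/density_gt0. Qed.

Let eF0 x : (0 <= (F x)%:E)%E. Proof. by rewrite lee_fin. Qed.

Lemma density1 : F 1%g = 1.
Proof.
apply: EFin_inj; rewrite FE (_ : [set _ | _] = [set [::]]).
  by rewrite esum_set1// weight_nil.
apply/seteqP; split=> [v /(run_eq1 run)//|_ ->]; exact: word_prod_nil.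
Qed.

Lemma density_mass : mass F setT = (q^-1)%:E.
Proof.
rewrite /mass; under eq_esum => x _ do rewrite FE.
by rewrite esum_fibres.
Qed.

Lemma normalized_density x : normalized F x = q * F x.
Proof. by rewrite /normalized density_mass/= invrK mulrC. Qed.

(** Grouping by words, the left side is the sum of [weight r v * P (prod v) y]
    over all words [v]. For [y <> 1] such a term collects the words [rcons v i] with
    product [y]; for [y = 1] every state resets with probability [q]. *)
Lemma density_invariant y : \esum_(x in setT) (F x * P x y)%:E = (F y)%:E.
Proof.
have aP0 v : (0 <= (wt v * P (prod v) y)%:E)%E.
  by rewrite lee_fin mulr_ge0// ltW.
transitivity (\esum_(v in setT) (wt v * P (prod v) y)%:E).
  rewrite -(esum_fibres prod)//; apply: eq_esum => x _.
  rewrite mulrC EFinM FE -esumZl//; apply: eq_esum => v /= <-.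
  by rewrite mulrC EFinM.
have [->|/eqP y1] := eqVneq y 1%g.
  rewrite density1; under eq_esum => v _ do rewrite (P_resetE run) mulrC EFinM.
  by rewrite esumZl ?ltW// wt_sum -EFinM mulfV// gt_eqF.
rewrite FE [RHS]esum_mkcond [RHS]esum_words_rcons; last by move=> v; case: ifP.
rewrite memNset ?add0e; last by rewrite /= word_prod_nil => /esym.
apply: eq_esum => v _; rewrite EFinM (P_stepE run)// -esumZl ?ltW//; last first.
  by move=> i; rewrite lee_fin ltW// (run_gt0 run).
rewrite esum_mkcond; apply: eq_esum => i _; rewrite weight_rcons.
congr (if _ then _ else _); apply/idP/idP; rewrite !inE /= word_prod_rcons//.
Qed.

Lemma normalized_pdf : pdf (normalized F).
Proof.
split=> [x|]; first by rewrite normalized_density mulr_ge0// ltW.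
rewrite /mass; under eq_esum => x _ do rewrite normalized_density EFinM.
by rewrite esumZl ?ltW// -/(mass F setT) density_mass -EFinM mulfV// gt_eqF.
Qed.

(** Every state resets to the identity, from which every state is reached by
    spelling a word. *)
Lemma run_irreducible : irreducible_transition P.
Proof.
move=> Z [z Zz] Zback x; suff Z1 : Z 1%g.
  by apply: (Zback x 1%g) => //; rewrite (P_resetE run).
move: Zz; have [v <-] := run_gen run z.
elim/last_ind: v => [|v i IHv]; first by rewrite word_prod_nil.
rewrite word_prod_rcons => /Zback Zv; apply/IHv/Zv.
by rewrite (run_up run) (run_gt0 run).
Qed.

Lemma the_invariant_density : is_the_invariant_pdf P (normalized F).
Proof.
have inv : invariant_pdf P (normalized F).
  split=> [|y]; first exact: normalized_pdf.
  under eq_esum => x _ do rewrite normalized_density -mulrA EFinM.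
  rewrite esumZl ?ltW// => [|x]; last by rewrite lee_fin mulr_ge0.
  by rewrite density_invariant normalized_density.
split=> // h hinv; apply: (irreducible_invariant_unique (run_pdf run)) => //.
exact: run_irreducible.
Qed.

Section Reversal.
Variable Q : M -> M -> R.
Hypothesis QE : forall x y, F y * Q y x = F x * P x y.

Let Q_E y x : Q y x = (F y)^-1 * (F x * P x y).
Proof. by rewrite -QE mulKf// gt_eqF// density_gt0. Qed.

Lemma reversal_gt0 y x : (0 < Q y x) = (0 < P x y).
Proof. by rewrite Q_E pmulr_rgt0 ?invr_gt0 ?pmulr_rgt0// ?density_gt0. Qed.

Lemma reversal_transition : transition_function Q.
Proof.
move=> y; split=> [x|].
  by rewrite Q_E mulr_ge0 ?invr_ge0 ?mulr_ge0.
rewrite /mass; under eq_esum => x _ do rewrite Q_E EFinM.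
rewrite esumZl ?invr_ge0// => [|x]; last by rewrite lee_fin mulr_ge0.
by rewrite density_invariant -EFinM mulVf// gt_eqF// density_gt0.
Qed.

Lemma reversal_from1 : Q 1%g = normalized F.
Proof.
apply/funext => x; rewrite Q_E density1 invr1 mul1r (P_resetE run).
by rewrite normalized_density mulrC.
Qed.

(** The reversed chain jumps from the identity to any state and returns to it by
    removing the letters of a word one at a time. *)
Lemma reversal_irreducible : irreducible_transition Q.
Proof.
move=> Z [z Zz] Zback x; have [v <-] := run_gen run x.
elim/last_ind: v => [|v i IHv].
  apply: (Zback _ z) => //; rewrite word_prod_nil reversal_from1.
  by rewrite normalized_density mulr_gt0// density_gt0.
apply: (Zback _ _ IHv); rewrite reversal_gt0 word_prod_rcons (run_up run).
exact: (run_gt0 run).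
Qed.

Lemma reversal_the_invariant : is_the_invariant_pdf Q (normalized F).
Proof.
have inv : invariant_pdf Q (normalized F).
  split=> [|y]; first exact: normalized_pdf.
  under eq_esum => x _ do rewrite normalized_density -mulrA QE mulrA EFinM.
  rewrite esumZl; [|by rewrite mulr_ge0// ltW|by move=> x; rewrite lee_fin].
  have [_ Py1] := run_pdf run y.
  by rewrite -/(mass (P y) setT) Py1 mule1 normalized_density.
split=> // h hinv.
apply: (irreducible_invariant_unique reversal_transition) => //.
exact: reversal_irreducible.
Qed.

End Reversal.
End InvariantDensity.

(** * Positive semigroups and free semigroups *)

Section PositiveSemigroup.
Variable S : monoidType.
Hypothesis hS : positive_semigroup S.
Implicit Types x y t : S.

Definition gen (i : irreducibles S) : S := val i.

Lemma gen_neq1 i : gen i <> 1%g.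
Proof. by have /set_mem[] := valP i. Qed.

Lemma gen_inj : injective gen.
Proof. exact: val_inj. Qed.

(** Write [y = x * t]. A proper factorisation [t = u * v] would put [x * u]
    strictly between [x] and [y]. *)
Lemma cover_gen x y : covers y x -> exists i, (x * gen i)%g = y.
Proof.
move=> [[[t xt] xy] ymin].
have t_irr : irreducibles S t.
  split=> [t1|u v tuv]; first by apply: xy; rewrite -xt t1 mulg1.
  have [u1|u1] := pselect (u = 1%g); [by left|right].
  apply: (left_cancellation hS (x := (x * u)%g)); rewrite mulg1 -mulgA -tuv xt.
  apply/esym/ymin; last by exists v; rewrite -mulgA -tuv.
  split=> [|xu]; first by exists u.
  by apply: u1; apply: (left_cancellation hS (x := x)); rewrite mulg1 -xu.
by exists (exist _ t (mem_set t_irr)).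
Qed.

Lemma gen_words_eq1 w : word_prod gen w = 1%g -> w = [::].
Proof.
case: w => // i w; rewrite word_prod_cons => /(no_inverses hS)[/gen_neq1].
by [].
Qed.

(** Finite by the local finiteness of the order; the measure for inductions
    along the order. *)
Definition rank x : nat :=
  size (finmap.enum_fset (fset_set [set t | prec t x])).

(** Strictness needs that [prec] is antisymmetric, which follows from
    cancellation and the absence of inverses. *)
Lemma rank_lt x y : sprec x y -> (rank x < rank y)%N.
Proof.
move=> [[t xt] xy]; apply: finmap.fproper_ltn_card.
have fin z := finite_intervals hS z.
rewrite finmap.fproperE; apply/andP; split.
  apply/finmap.fsubsetP => u; rewrite !in_fset_set// !inE => -[v uv].
  by exists (v * t)%g; rewrite mulgA uv.
apply/negP => /finmap.fsubsetP/(_ y); rewrite !in_fset_set// !inE.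
case=> [|u yu]; first by exists 1%g; rewrite mulg1.
apply: xy; rewrite -xt.
have : (x * (t * u))%g = (x * 1)%g by rewrite mulgA xt mulg1.
by move=> /(left_cancellation hS)/(no_inverses hS)[-> _]; rewrite mulg1.
Qed.

(** Take a proper prefix of [x] of the largest rank. *)
Lemma exists_lower_cover x : x <> 1%g -> exists y, covers x y.
Proof.
move=> x1; pose P k := `[< exists2 u, sprec u x & rank u = k >].
have exP : exists k, P k.
  exists (rank 1%g); apply/asboolP; exists 1%g => //.
  by split=> [|/esym//]; exists x; rewrite mul1g.
have ubP k : P k -> (k <= rank x)%N.
  by move=> /asboolP[u /rank_lt ux <-]; exact: ltnW.
case: (ex_maxnP exP ubP) => k /asboolP[u ux uk] kmax.
exists u; split=> // t ut tx; apply: contrapT => nx.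
have := kmax (rank t); rewrite leqNgt -uk rank_lt// => /(_ _)/negP.
by case=> //; apply/asboolP; exists t.
Qed.

(** Induction on the rank: a lower cover of [x] has smaller rank, and [x] arises
    from it by one more generator. *)
Lemma gen_words_surj x : exists w, word_prod gen w = x.
Proof.
have [n] := ubnP (rank x); elim: n => // n IHn in x *.
have [->|x1] := pselect (x = 1%g); first by exists [::]; exact: word_prod_nil.
have [y yx] := exists_lower_cover x1; rewrite ltnS => /(leq_trans _) xn.
have [w wy] := IHn _ (xn _ (rank_lt yx.1)).
have [i yi] := cover_gen yx; exists (rcons w i).
by rewrite word_prod_rcons wy.
Qed.

(** An upward run chain moves only to covers, which are the [x * gen i], or to
    the identity; the latter thus receives the mass that the rates leave over. *)
Lemma semigroup_run (R : realType) (r : irreducibles S -> R) (P : S -> S -> R) :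
  (forall i, 0 < r i) -> (mass r setT < 1)%E -> upward_run_chain P ->
  (forall x i, P x (x * val i)%g = r i) -> homogeneous_run gen r P.
Proof.
move=> r0 r1 [hP Psupp] Pup.
have gcan x y z : (x * y)%g = (x * z)%g -> y = z by exact: left_cancellation.
split=> // [||x].
- exact: gen_words_eq1.
- exact: gen_words_surj.
have [P0 P1] := hP x.
have xg1 i : (x * gen i)%g <> 1%g by move=> /(no_inverses hS)[_ /gen_neq1].
have := mass_up_or_reset (gcan x) gen_inj xg1 P0 (Pup x).
set U := (U in mass _ U); have -> : mass (P x) U = 1%E.
  rewrite -P1 /mass [RHS](esumID U); last by move=> y _; rewrite lee_fin.
  rewrite !setTI [X in _ = (_ + X)%E]esum1 ?adde0//.
  move=> y Uy; congr (_ %:E); apply/eqP; apply: contrapT => /negP Py.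
  apply: Uy; have : 0 < P x y by rewrite lt_def Py P0.
  by move/Psupp => [/cover_gen[i xi]|->]; [right; exists i|left].
move=> ->; rewrite addeK// ge0_fin_numE ?esum_ge0//.
  exact: (lt_trans r1 (ltry 1)).
by move=> i _; rewrite lee_fin ltW.
Qed.

End PositiveSemigroup.

Section FreeSemigroup.
Variable I : choiceType.
Local Notation W := (free_semigroup I).

Lemma word_prod_letter (w : seq I) : word_prod (@letter I) w = w.
Proof.
by elim: w => [|i w IHw]; rewrite ?word_prod_nil// word_prod_cons IHw.
Qed.

Lemma mulw_inj (x y z : W) : (x * y)%g = (x * z)%g -> y = z.
Proof. by move=> /(congr1 (drop (size x))); rewrite !drop_size_cat. Qed.

Lemma free_run (R : realType) (r : I -> R) (P : W -> W -> R) :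
  (forall i, 0 < r i) -> (mass r setT < 1)%E -> transition_function P ->
  (forall a i, P a (a * letter i)%g = r i) ->
  (forall a, ((P a 1%g)%:E = 1 - mass r [set: I])%E) ->
  homogeneous_run (@letter I) r P.
Proof.
move=> r0 r1 hP Pup Preset; split=> //.
- exact: mulw_inj.
- by move=> i j [].
- by move=> w; rewrite word_prod_letter.
- by move=> w; exists w; rewrite word_prod_letter.
Qed.

End FreeSemigroup.

Lemma prodr_count (R : realType) (I : choiceType) (r : I -> R) (w : seq I) :
  \prod_(i <- w) r i = \big[*%R/1]_(i \in [set: I]) r i ^+ count_mem i w.
Proof.
rewrite (fsbigE (undup w)) ?undup_uniq//; last first.
  by move=> i _; rewrite mem_undup => /count_memPn ->.
rewrite -big_undup_iterop_count/=; by apply: eq_bigl => i; rewrite in_setT.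
Qed.

(** Weights are multiplicative under concatenation, so that shifting a set by
    [x] multiplies its mass by [weight r x]. *)
Lemma exponential_weight (R : realType) (I : choiceType) (r : I -> R)
    (f : free_semigroup I -> R) (c : R) :
  (forall i, 0 < r i) -> (forall w, f w = c * weight r w) -> 0 <= c ->
  mass f setT = 1%E -> exponential_distribution f.
Proof.
move=> r0 fE c0 f1 x A.
have f0 w : (0 <= (f w)%:E)%E.
  by rewrite lee_fin fE mulr_ge0// ltW// weight_gt0.
have shift B : mass f [set (x * b)%g | b in B] = ((weight r x)%:E * mass f B)%E.
  rewrite /mass esum_image; last first.
    by move=> u v _ _; exact: mulw_inj.
  rewrite -esumZl// ?ltW ?weight_gt0//; apply: eq_esum => b _.
  by rewrite !fE weight_cat -EFinM mulrCA.
by rewrite !shift f1 mule1.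
Qed.

(** * The upward run chains on words and on the semigroup *)

Theorem mainTheorem15 (R : realType) (S : monoidType)
    (hS : positive_semigroup S)
    (r : irreducibles S -> R)
    (r_gt0 : forall i, 0 < r i)
    (r_lt1 : (mass r [set: irreducibles S] < 1)%E)
    (* the chain on S *)
    (P : S -> S -> R)
    (hP : upward_run_chain P)
    (P_homogeneous : forall (x : S) (i : irreducibles S),
        P x (x * val i)%g = r i)
    (d : measure_display) (Omega : measurableType d)
    (Pr : S -> probability Omega R) (X : nat -> Omega -> S)
    (hX : markov_chain P Pr X)
    (* the chain on words *)
    (P' : free_semigroup (irreducibles S) ->
          free_semigroup (irreducibles S) -> R)
    (hP' : transition_function P')
    (P'_letter : forall a (i : irreducibles S), P' a (a * letter i)%g = r i)
    (P'_empty : forall a,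
        ((P' a 1%g)%:E = 1 - mass r [set: irreducibles S])%E)
    (d' : measure_display) (Omega' : measurableType d')
    (Pr' : free_semigroup (irreducibles S) -> probability Omega' R)
    (X' : nat -> Omega' -> free_semigroup (irreducibles S))
    (hX' : markov_chain P' Pr' X') :
  let F := standard_invariant Pr X in
  let F' := standard_invariant Pr' X' in
  [/\ (* (a) *)
      forall a : free_semigroup (irreducibles S),
        F' a = \prod_(i <- a) r i /\
        F' a = \big[*%R/1]_(i \in [set: irreducibles S]) r i ^+ count_mem i a,
      (* (b) *)
      [/\ positive_recurrent Pr' X',
          positive_recurrent Pr X,
          is_the_invariant_pdf P' (normalized F') &
          exponential_distribution (normalized F')],
      (* (c) *)
      forall x : S, (F x)%:E = mass F' [set a | word_product a = x] &
      (* (d) *)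
      forall Q : S -> S -> R,
        (forall x y, F y * Q y x = F x * P x y) ->
        [/\ downward_run_chain Q,
            Q 1%g = normalized F,
            is_the_invariant_pdf P (normalized F) &
            is_the_invariant_pdf Q (normalized F)]].
Proof.
have run := semigroup_run hS r_gt0 r_lt1 hP P_homogeneous.
have run' := free_run r_gt0 r_lt1 hP' P'_letter P'_empty.
move=> F F'.
have FE := standard_invariantE run hX.
have FE' := standard_invariantE run' hX'.
have wt_sum := weight_sum run hX.
have F'E a : F' a = weight r a.
  apply: EFin_inj; rewrite FE' (_ : [set _ | _] = [set a]).
    by rewrite esum_set1// lee_fin ltW// weight_gt0.
  by apply/seteqP; split=> v /=; rewrite word_prod_letter.
split.
- by move=> a; rewrite F'E; split=> //; exact: prodr_count.
- split.
  + exact (homogeneous_positive_recurrent run' hX').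
  + exact (homogeneous_positive_recurrent run hX).
  + exact (the_invariant_density run' FE' wt_sum).
  + apply: (@exponential_weight _ _ r _ (reset_rate r)) => //.
    * by move=> w; rewrite (normalized_density run' FE' wt_sum) -F'E.
    * exact/ltW/(reset_rate_gt0 run).
    * by have [] := normalized_pdf run' FE' wt_sum.
- by move=> x; rewrite FE /mass; apply: eq_esum => v _; rewrite F'E.
- move=> Q QE; split.
  + split=> [|x y]; first exact (reversal_transition run FE wt_sum QE).
    rewrite (reversal_gt0 run FE QE) (hP.2 y x).
    split=> [[xy|->]|[->|[_ xy]]]; [|by left|by right|by left].
    by have [->|x1] := pselect (x = 1%g); [left|right].
  + exact (reversal_from1 run FE wt_sum QE).
  + exact (the_invariant_density run FE wt_sum).
  + exact (reversal_the_invariant run FE wt_sum QE).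
Qed.
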